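(* Let $\gamma\in\mathbb{R}$, $\beta>0$ and let $n\ge0$ be an integer. The polynomial $$\mathcal{L}_n^{(1-2n-\gamma,\beta)}(x)=x^nL_n^{1-2n-\gamma}(\beta/x)$$ is, up to normalization (a nonzero constant factor), the generalized Bessel polynomial $\mathcal{B}_n^{(\gamma,\beta)}(x)$.
   Context: $L_n^\alpha(x)=\sum_{k=0}^n\binom{n+\alpha}{n-k}\frac{(-x)^k}{k!}$ is the associated Laguerre polynomial (for arbitrary real $\alpha$, with $\binom{n+\alpha}{n-k}=\frac{(\alpha+k+1)(\alpha+k+2)\cdots(\alpha+n)}{(n-k)!}$). The generalized Bessel polynomial $\mathcal{B}_n^{(\gamma,\beta)}$ is, up to normalization, the polynomial solution with nonzero constant term of the Krall–Frink differential equation $x^2y''(x)+(\beta+\gamma x)y'(x)-n(n+\gamma-1)y(x)=0$. *)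

(* Defs.v *)
From HB Require Import structures.
From mathcomp Require Import all_boot all_order all_algebra.
From mathcomp Require Import reals.

Set Implicit Arguments.
Unset Strict Implicit.
Unset Printing Implicit Defensive.

Import Order.TTheory GRing.Theory Num.Theory.
Local Open Scope ring_scope.

(* For k <= n, the binomial coefficient "n + a choose n - k" with a real:
   (a + k + 1) (a + k + 2) ... (a + n) / (n - k)!. *)
Definition laguerre_binom (R : realType) (n : nat) (a : R) (k : nat) : R :=
  (\prod_(k.+1 <= i < n.+1) (a + i%:R)) / ((n - k)`!)%:R.

Definition laguerre (R : realType) (n : nat) (a : R) : {poly R} :=
  \sum_(k < n.+1) (laguerre_binom n a k / (k`!)%:R) *: (- 'X) ^+ k.

(* The polynomial x^n L(b / x), where L := laguerre n a has degree at most n: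
   the term L_k x^k of L contributes L_k b^k x^(n - k). *)
Definition laguerre_rev (R : realType) (n : nat) (a b : R) : {poly R} :=
  \sum_(k < n.+1) ((laguerre n a)`_k * b ^+ k) *: 'X^(n - k).

Definition krall_frink (R : realType) (n : nat) (g b : R) (y : {poly R}) :
    Prop :=
  'X^2 * y^`(2) + (b%:P + g *: 'X) * y^`()
    - (n%:R * (n%:R + g - 1)) *: y = 0.

(* The generalized Bessel polynomial is defined only up to normalization, so
   it is represented by the predicate its normalizations satisfy; no condition
   is put on the degree, which is below n for some g. *)
Definition is_gen_bessel (R : realType) (n : nat) (g b : R) (y : {poly R}) :
    Prop :=
  krall_frink n g b y /\ y`_0 != 0.

(* Main.v *)
Require Import Defs.
From HB Require Import structures.
From mathcomp Require Import all_boot all_order all_algebra.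
From mathcomp Require Import reals.
From mathcomp Require Import ring.

(** On coefficients the Krall-Frink equation is the two-term recurrence
    [b (j + 1) y_(j+1) = (n - j) (n + j + g - 1) y_j]. As [b != 0], it determines
    [y] from [y_0], which gives uniqueness up to a factor; and the coefficients
    of [x^n L(b / x)] satisfy it because consecutive generalized binomials
    differ by the factor [(a + k) / (n - k + 1)], whose numerator for
    [a = 1 - 2n - g] and [k = n - j] is [-(n + j + g - 1)]. *)

Set Implicit Arguments.
Unset Strict Implicit.
Unset Printing Implicit Defensive.

Import Order.TTheory GRing.Theory Num.Theory.
Local Open Scope ring_scope.

Lemma krall_frink_coefP (R : realType) (n : nat) (g b : R) (y : {poly R}) :
  krall_frink n g b y <->
  (forall j, b * j.+1%:R * y`_j.+1 =
             (n%:R - j%:R) * (n%:R + j%:R + g - 1) * y`_j).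
Proof.
have coefE j : ('X^2 * y^`(2) + (b%:P + g *: 'X) * y^`()
                 - (n%:R * (n%:R + g - 1)) *: y)`_j =
    b * j.+1%:R * y`_j.+1 - (n%:R - j%:R) * (n%:R + j%:R + g - 1) * y`_j.
  rewrite coefB coefD mulrDl coefD -scalerAl !coefZ coefCM coefXM coefXnM.
  rewrite derivnS derivn1 !coef_deriv.
  (* Multiplying by ['X] or ['X^2] shifts indices with default value 0 below, hence the separate
     cases [j = 0] and [j = 1]. *)
  case: j => [|[|j]]; rewrite ?subn2 /= ?coef_deriv; ring.
rewrite /krall_frink; split=> [eq0 j | rec].
  by apply/eqP; rewrite -subr_eq0 -coefE eq0 coef0.
by apply/polyP => j; rewrite coefE rec subrr coef0.
Qed.

Lemma laguerreE (R : realType) (n : nat) (a : R) :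
  laguerre n a =
  \poly_(k < n.+1) ((-1) ^+ k * laguerre_binom n a k / (k`!)%:R).
Proof.
rewrite poly_def; apply: eq_bigr => k _.
rewrite (exprNn 'X) -[in LHS]signr_odd -[in RHS]signr_odd -[in RHS]mulrA !mulr_sign.
by case: (odd k); rewrite ?scalerN ?scaleNr.
Qed.

(** Summing by the exponent [j = n - k] of ['X] makes each coefficient readable by [coef_poly]. *)
Lemma laguerre_revE (R : realType) (n : nat) (a b : R) :
  laguerre_rev n a b =
  \poly_(j < n.+1) ((laguerre n a)`_(n - j) * b ^+ (n - j)).
Proof.
rewrite poly_def /laguerre_rev (reindex_inj rev_ord_inj) /=.
by apply: eq_bigr => j _; rewrite subSS subKn // -ltnS.
Qed.

(** Passing from [k] to [k.+1] drops the factor [a + k.+1%:R] from the product and the factor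
    [n - k] from the factorial. *)
Lemma laguerre_binomS (R : realType) (n : nat) (a : R) (k : nat) :
  (k < n)%N ->
  (n - k)%:R * laguerre_binom n a k = (a + k.+1%:R) * laguerre_binom n a k.+1.
Proof.
move=> lt_kn; rewrite /laguerre_binom (big_ltn (m := k.+1)) ?ltnS //.
have -> : (n - k = (n - k.+1).+1)%N by rewrite subnSK.
rewrite factS natrM.
have f0 : ((n - k.+1)`!)%:R != 0 :> R by rewrite pnatr_eq0 -lt0n fact_gt0.
have s0 : (n - k.+1).+1%:R != 0 :> R by rewrite pnatr_eq0.
by field; rewrite f0 nat1r s0.
Qed.

Lemma laguerre_rev_coef0_neq0 (R : realType) (n : nat) (a b : R) :
  b != 0 -> (laguerre_rev n a b)`_0 != 0.
Proof.
move=> b0; rewrite laguerre_revE coef_poly /= subn0 laguerreE coef_poly ltnSn.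
rewrite /laguerre_binom big_geq // subnn divr1 mulr1.
by rewrite !mulf_neq0 ?invr_eq0 ?expf_neq0 ?oppr_eq0 ?oner_eq0 // pnatr_eq0
  -lt0n fact_gt0.
Qed.

Lemma horner_laguerre_rev (R : realType) (n : nat) (a b x : R) :
  x != 0 -> (laguerre_rev n a b).[x] = x ^+ n * (laguerre n a).[b / x].
Proof.
move=> x0.
rewrite (@horner_coef_wide _ n.+1 (laguerre n a)); last first.
  by rewrite laguerreE size_poly.
rewrite mulr_sumr /laguerre_rev horner_sum; apply: eq_bigr => k _.
rewrite hornerZ hornerXn expr_div_n.
have -> : x ^+ n = x ^+ (n - k) * x ^+ k.
  by rewrite -exprD subnK // -ltnS.
have xk0 : x ^+ k != 0 by rewrite expf_neq0.
by field.
Qed.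

Lemma krall_frink_laguerre_rev (R : realType) (n : nat) (g b : R) :
  krall_frink n g b (laguerre_rev n (1 - 2%:R * n%:R - g) b).
Proof.
set a := _ - g; apply/krall_frink_coefP => j.
rewrite laguerre_revE !coef_poly !ltnS.
(* At [j = n] the factor [n - j] vanishes along with the coefficient of index [n.+1]; beyond [n]
   both coefficients are 0. *)
case: (ltngtP j n) => [lt_jn | _ | ->]; first last.
- by rewrite subrr !mul0r mulr0.
- by rewrite !mulr0.
rewrite laguerreE !coef_poly !ltnS !leq_subr.
have [k nE] : exists k, n = (k + j.+1)%N by exists (n - j.+1)%N; rewrite subnK.
have -> : (n - j.+1 = k)%N by rewrite nE addnK.
have -> : (n - j = k.+1)%N by rewrite nE addnS -addSn addnK.
have : (k < n)%N by rewrite nE addnS ltnS leq_addr.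
move=> /(laguerre_binomS a).
have -> : (n - k = j.+1)%N by rewrite nE addKn.
have -> : a + k.+1%:R = - (n%:R + j%:R + g - 1).
  by rewrite /a nE natrD -!natr1; ring.
have -> : n%:R - j%:R = k.+1%:R :> R by rewrite nE natrD -!natr1; ring.
set B := laguerre_binom n a k; set B' := laguerre_binom n a k.+1 => binS.
have f0 : (k`!)%:R != 0 :> R by rewrite pnatr_eq0 -lt0n fact_gt0.
have s0 : k.+1%:R != 0 :> R by rewrite pnatr_eq0.
rewrite factS natrM !exprS.
(* This isolates [j.+1%:R * B], the left side of [binS]; the minus sign that [binS] brings in
   accounts for [(-1) ^+ k.+1]. *)
transitivity (b * b ^+ k * (-1) ^+ k / (k`!)%:R * (j.+1%:R * B)); first ring.
rewrite binS.
by field; rewrite f0 nat1r s0.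
Qed.

(** The cross-multiplied form avoids division and suits induction on the index: both sides obey the
    same recurrence, whose factor [b * j.+1%:R] can be cancelled. *)
Lemma krall_frink_proportional (R : realType) (n : nat) (g b : R)
    (y z : {poly R}) :
  b != 0 -> krall_frink n g b y -> krall_frink n g b z ->
  z`_0 *: y = y`_0 *: z.
Proof.
move=> b0 /krall_frink_coefP recy /krall_frink_coefP recz.
apply/polyP; elim=> [|j IHj]; rewrite !coefZ; first by rewrite mulrC.
have bj0 : b * j.+1%:R != 0 by rewrite mulf_neq0 // pnatr_eq0.
apply: (mulfI bj0); rewrite !(mulrCA (b * _)) recy recz.
by move: IHj; rewrite !coefZ => IHj; rewrite mulrCA IHj mulrCA.
Qed.

Theorem mainTheorem10 (R : realType) (g b : R) (hb : 0 < b) (n : nat) :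
  let a : R := 1 - 2%:R * n%:R - g in
  (forall x : R, x != 0 ->
     (laguerre_rev n a b).[x] = x ^+ n * (laguerre n a).[b / x]) /\
  is_gen_bessel n g b (laguerre_rev n a b) /\
  (forall B : {poly R}, is_gen_bessel n g b B ->
     exists c : R, c != 0 /\ laguerre_rev n a b = c *: B).
Proof.
move=> a; have b0 : b != 0 by rewrite gt_eqF.
have Lkf : krall_frink n g b (laguerre_rev n a b).
  exact: krall_frink_laguerre_rev.
have L0 := laguerre_rev_coef0_neq0 n a b0.
split; first by move=> x; apply: horner_laguerre_rev.
split=> // B [Bkf B0].
(* Comparing constant terms forces this ratio. *)
exists ((laguerre_rev n a b)`_0 / B`_0); split.
  by rewrite mulf_neq0 // invr_eq0.
apply: (scalerI B0); rewrite (krall_frink_proportional b0 Lkf Bkf).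
by rewrite scalerA mulrCA divff // mulr1.
Qed.
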